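(* Let $M$ be a smooth manifold with a bivector field $\pi$, a vector field $\xi$ and a pseudo-Riemannian metric $g$. Assume that the skew algebroid $(T^*M,\sharp_{\pi,\xi},[\cdot,\cdot]_{\pi,\xi}^{g})$ is an almost Lie algebroid and that the anchor map $\sharp_{\pi,\xi}$ is an isometry. Then $$\sharp_{\pi,\xi}(\mathcal{D}_\alpha\beta)=\nabla_{\sharp_{\pi,\xi}(\alpha)}\sharp_{\pi,\xi}(\beta)\quad\text{for all }\alpha,\beta\in\Omega^1(M),$$ where $\mathcal{D}$ is the contravariant Levi-Civita derivative associated with $(\pi,\xi,g)$ and $\nabla$ is the Levi-Civita (covariant) connection of $g$.
   Context: Notation: $\flat_g:TM\to T^*M$, $\flat_g(X)(Y)=g(X,Y)$; $\sharp_g=\flat_g^{-1}$; cometric $g^*(\alpha,\beta)=g(\sharp_g(\alpha),\sharp_g(\beta))$. The endomorphism field $J$ of $TM$ is defined by $g(J\sharp_g(\alpha),\sharp_g(\beta))=\pi(\alpha,\beta)$. Define $\sharp_\pi:T^*M\to TM$ by $\beta(\sharp_\pi(\alpha))=\pi(\alpha,\beta)$, $\sharp_{\pi,\xi}(\alpha)=\sharp_\pi(\alpha)+\alpha(\xi)\xi$, $[\alpha,\beta]_\pi=\mathcal{L}_{\sharp_\pi(\alpha)}\beta-\mathcal{L}_{\sharp_\pi(\beta)}\alpha-d(\pi(\alpha,\beta))$, and $$[\alpha,\beta]_{\pi,\xi}^{g}=[\alpha,\beta]_\pi+\alpha(\xi)(\mathcal{L}_\xi\beta-\beta)-\beta(\xi)(\mathcal{L}_\xi\alpha-\alpha)-\pi(\alpha,\beta)\lambda,\qquad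 \lambda=g(\xi,\xi)\flat_g(\xi)-\flat_g(J\xi).$$ The triple $(T^*M,\sharp_{\pi,\xi},[\cdot,\cdot]_{\pi,\xi}^{g})$ is a skew algebroid (alternating $\mathbb{R}$-bilinear bracket satisfying the Leibniz rule with anchor $\sharp_{\pi,\xi}$); it is an almost Lie algebroid if $\sharp_{\pi,\xi}([\alpha,\beta]_{\pi,\xi}^{g})=[\sharp_{\pi,\xi}(\alpha),\sharp_{\pi,\xi}(\beta)]$ for all $\alpha,\beta$. ''$\sharp_{\pi,\xi}$ is an isometry'' means $g(\sharp_{\pi,\xi}(\alpha),\sharp_{\pi,\xi}(\beta))=g^*(\alpha,\beta)$ for all $\alpha,\beta$. The contravariant Levi-Civita derivative $\mathcal{D}:\Omega^1(M)\times\Omega^1(M)\to\Omega^1(M)$ associated with $(\pi,\xi,g)$ is the unique contravariant derivative (with respect to the anchor $\sharp_{\pi,\xi}$) that is symmetric ($\mathcal{D}_\alpha\beta-\mathcal{D}_\beta\alpha=[\alpha,\beta]_{\pi,\xi}^{g}$) and compatible with $g^*$; it is characterized by $$2g^*(\mathcal{D}_\alpha\beta,\gamma)=\sharp_{\pi,\xi}(\alpha)\cdot g^*(\beta,\gamma)+\sharp_{\pi,\xi}(\beta)\cdot g^*(\alpha,\gamma)-\sharp_{\pi,\xi}(\gamma)\cdot g^*(\alpha,\beta)-g^*([\beta,\gamma]_{\pi,\xi}^{g},\alpha)-g^*([\alpha,\gamma]_{\pi,\xi}^{g},\beta)+g^*([\alpha,\beta]_{\pi,\xi}^{g},\gamma).$$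 *)

(* Defs.v *)
From HB Require Import structures.
From mathcomp Require Import all_boot all_order all_algebra.
From mathcomp Require Import all_classical all_reals all_analysis.

Set Implicit Arguments.
Unset Strict Implicit.
Unset Printing Implicit Defensive.

Import Order.TTheory GRing.Theory Num.Theory.
Import numFieldNormedType.Exports.

Local Open Scope classical_set_scope.
Local Open Scope ring_scope.

(* f is C^oo on the open set U: every iterated directional derivative of f is
   Frechet differentiable at every point of U. *)
Definition smooth_on (R : realType) (V W : normedModType R)
    (U : set V) (f : V -> W) : Prop :=
  forall (s : seq V) (x : V), U x ->
    differentiable (foldr (fun v h => 'D_v h) f s) x.

Record chart (R : realType) (n : nat) (T : topologicalType) := Chart {
  chart_dom : set T;
  chart_to : T -> 'rV[R]_n;
  chart_of : 'rV[R]_n -> T;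
  chart_dom_open : open chart_dom;
  chart_img_open : open (chart_to @` chart_dom);
  chart_toK : forall p, chart_dom p -> chart_of (chart_to p) = p;
  chart_to_cont : {in chart_dom, continuous chart_to};
  chart_of_cont : {in chart_to @` chart_dom, continuous chart_of} }.

Definition transition (R : realType) (n : nat) (T : topologicalType)
    (c c' : chart R n T) : 'rV[R]_n -> 'rV[R]_n :=
  chart_to c' \o chart_of c.

(* The atlas need not be maximal, and the carrier may be empty or
   disconnected. *)
Record manifold (R : realType) (n : nat) := Manifold {
  carrier :> topologicalType;
  atlas : set (chart R n carrier);
  manifold_hausdorff : hausdorff_space carrier;
  manifold_second_countable : @second_countable carrier;
  atlas_cover : forall p, exists2 c, atlas c & chart_dom c p;
  atlas_compat : forall c c', atlas c -> atlas c' ->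
    smooth_on (chart_to c @` (chart_dom c `&` chart_dom c'))
              (transition c c') }.

(* A chart of the atlas around p, selected once and for all. It identifies the
   tangent space at p with row vectors 'rV_n and the cotangent space at p with
   column vectors 'cV_n, the value of a covector a on a vector v being the
   entry of v *m a. Hence, as sections of bundles over M:
     a vector field is a map M -> 'rV_n,
     a 1-form is a map M -> 'cV_n,
     a bivector field is a map pi : M -> 'M_n, with
       pi(a, b) = a^T *m pi *m b on covectors,
     a covariant 2-tensor is a map g : M -> 'M_n, with
       g(v, w) = v *m g *m w^T on vectors,
   all expressed at p in the coordinates of chart_at p. *)
Definition chart_at (R : realType) (n : nat) (M : manifold R n) (p : M) :
    chart R n M :=
  s2val (cid2 (atlas_cover p)).

(* Components in an arbitrary chart c, as functions of the coordinates x of c.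
   The jacobian acts on row vectors from the right. *)
Definition jac_from (R : realType) (n : nat) (M : manifold R n)
    (c : chart R n M) (q : M) : 'M[R]_n :=
  'J (transition (chart_at q) c) (chart_to (chart_at q) q).

Definition jac_to (R : realType) (n : nat) (M : manifold R n)
    (c : chart R n M) (q : M) : 'M[R]_n :=
  'J (transition c (chart_at q)) (chart_to c q).

Definition fun_in (R : realType) (n : nat) (M : manifold R n)
    (c : chart R n M) (f : M -> R) : 'rV[R]_n -> R :=
  fun x => f (chart_of c x).

Definition vf_in (R : realType) (n : nat) (M : manifold R n)
    (c : chart R n M) (X : M -> 'rV[R]_n) : 'rV[R]_n -> 'rV[R]_n :=
  fun x => let q := chart_of c x in X q *m jac_from c q.

Definition form_in (R : realType) (n : nat) (M : manifold R n)
    (c : chart R n M) (a : M -> 'cV[R]_n) : 'rV[R]_n -> 'cV[R]_n :=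
  fun x => let q := chart_of c x in jac_to c q *m a q.

Definition bivector_in (R : realType) (n : nat) (M : manifold R n)
    (c : chart R n M) (pi : M -> 'M[R]_n) : 'rV[R]_n -> 'M[R]_n :=
  fun x => let q := chart_of c x in (jac_from c q)^T *m pi q *m jac_from c q.

Definition cotensor_in (R : realType) (n : nat) (M : manifold R n)
    (c : chart R n M) (g : M -> 'M[R]_n) : 'rV[R]_n -> 'M[R]_n :=
  fun x => let q := chart_of c x in jac_to c q *m g q *m (jac_to c q)^T.

Definition smooth_in_charts (R : realType) (n : nat) (M : manifold R n)
    (W : normedModType R) (rep : chart R n M -> 'rV[R]_n -> W) : Prop :=
  forall c, atlas c -> smooth_on (chart_to c @` chart_dom c) (rep c).

Definition smooth_fun (R : realType) (n : nat) (M : manifold R n)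
    (f : M -> R) : Prop :=
  smooth_in_charts (fun c => fun_in c f).

Definition vector_field (R : realType) (n : nat) (M : manifold R n)
    (X : M -> 'rV[R]_n) : Prop :=
  smooth_in_charts (fun c => vf_in c X).

Definition one_form (R : realType) (n : nat) (M : manifold R n)
    (a : M -> 'cV[R]_n) : Prop :=
  smooth_in_charts (fun c => form_in c a).

Definition bivector_field (R : realType) (n : nat) (M : manifold R n)
    (pi : M -> 'M[R]_n) : Prop :=
  smooth_in_charts (fun c => bivector_in c pi) /\
  (forall p, (pi p)^T = - pi p).

Definition pseudo_riemannian (R : realType) (n : nat) (M : manifold R n)
    (g : M -> 'M[R]_n) : Prop :=
  [/\ smooth_in_charts (fun c => cotensor_in c g),
      forall p, (g p)^T = g p
    & forall p, g p \in unitmx].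

Definition pairing (R : realType) (n : nat) (M : manifold R n)
    (a : M -> 'cV[R]_n) (X : M -> 'rV[R]_n) : M -> R :=
  fun p => (X p *m a p) 0 0.

Definition eval_bivector (R : realType) (n : nat) (M : manifold R n)
    (pi : M -> 'M[R]_n) (a b : M -> 'cV[R]_n) : M -> R :=
  fun p => ((a p)^T *m pi p *m b p) 0 0.

Definition eval_metric (R : realType) (n : nat) (M : manifold R n)
    (g : M -> 'M[R]_n) (X Y : M -> 'rV[R]_n) : M -> R :=
  fun p => (X p *m g p *m (Y p)^T) 0 0.

(* The operators below are the classical coordinate formulas, evaluated at p in
   the chart chart_at p, whose coordinates are those of the fibres at p. *)

(* X . f *)
Definition vf_act (R : realType) (n : nat) (M : manifold R n)
    (X : M -> 'rV[R]_n) (f : M -> R) : M -> R :=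
  fun p => let c := chart_at p in 'D_(X p) (fun_in c f) (chart_to c p).

(* df *)
Definition differential (R : realType) (n : nat) (M : manifold R n)
    (f : M -> R) : M -> 'cV[R]_n :=
  fun p => let c := chart_at p in
    \col_i 'D_(delta_mx 0 i) (fun_in c f) (chart_to c p).

(* [X, Y]^j = X^i d_i Y^j - Y^i d_i X^j *)
Definition lie_bracket (R : realType) (n : nat) (M : manifold R n)
    (X Y : M -> 'rV[R]_n) : M -> 'rV[R]_n :=
  fun p => let c := chart_at p in let x := chart_to c p in
    'D_(X p) (vf_in c Y) x - 'D_(Y p) (vf_in c X) x.

(* (L_X b)_i = X^j d_j b_i + b_j d_i X^j *)
Definition lie_form (R : realType) (n : nat) (M : manifold R n)
    (X : M -> 'rV[R]_n) (b : M -> 'cV[R]_n) : M -> 'cV[R]_n :=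
  fun p => let c := chart_at p in let x := chart_to c p in
    'D_(X p) (form_in c b) x + 'J (vf_in c X) x *m b p.

Definition flat (R : realType) (n : nat) (M : manifold R n)
    (g : M -> 'M[R]_n) (X : M -> 'rV[R]_n) : M -> 'cV[R]_n :=
  fun p => (X p *m g p)^T.

Definition sharp (R : realType) (n : nat) (M : manifold R n)
    (g : M -> 'M[R]_n) (a : M -> 'cV[R]_n) : M -> 'rV[R]_n :=
  fun p => (a p)^T *m invmx (g p).

Definition cometric (R : realType) (n : nat) (M : manifold R n)
    (g : M -> 'M[R]_n) (a b : M -> 'cV[R]_n) : M -> R :=
  eval_metric g (sharp g a) (sharp g b).

(* The endomorphism field J; its defining equation is lemma endoJP. *)
Definition endoJ (R : realType) (n : nat) (M : manifold R n)
    (pi g : M -> 'M[R]_n) (X : M -> 'rV[R]_n) : M -> 'rV[R]_n :=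
  fun p => X p *m (g p *m pi p).

(* The vector field with b(sharp_pi a) = pi(a, b), see lemma sharp_piP. *)
Definition sharp_pi (R : realType) (n : nat) (M : manifold R n)
    (pi : M -> 'M[R]_n) (a : M -> 'cV[R]_n) : M -> 'rV[R]_n :=
  fun p => (a p)^T *m pi p.

Lemma flat_pairing (R : realType) (n : nat) (M : manifold R n)
    (g : M -> 'M[R]_n) (X Y : M -> 'rV[R]_n) :
  pairing (flat g X) Y = eval_metric g X Y.
Proof.
apply/funext => p; rewrite /pairing /flat /eval_metric.
by rewrite -[Y p *m _]trmxK mxE trmx_mul trmxK.
Qed.

Lemma flatK (R : realType) (n : nat) (M : manifold R n) (g : M -> 'M[R]_n) :
  pseudo_riemannian g -> cancel (flat g) (sharp g).
Proof.
by case=> _ _ ug X; apply/funext => p; rewrite /sharp /flat trmxK mulmxK.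
Qed.

Lemma sharpK (R : realType) (n : nat) (M : manifold R n) (g : M -> 'M[R]_n) :
  pseudo_riemannian g -> cancel (sharp g) (flat g).
Proof.
by case=> _ _ ug a; apply/funext => p; rewrite /sharp /flat mulmxKV// trmxK.
Qed.

Lemma sharp_piP (R : realType) (n : nat) (M : manifold R n)
    (pi : M -> 'M[R]_n) (a b : M -> 'cV[R]_n) :
  pairing b (sharp_pi pi a) = eval_bivector pi a b.
Proof. by []. Qed.

Lemma endoJP (R : realType) (n : nat) (M : manifold R n)
    (pi g : M -> 'M[R]_n) (a b : M -> 'cV[R]_n) :
  pseudo_riemannian g ->
  eval_metric g (endoJ pi g (sharp g a)) (sharp g b) = eval_bivector pi a b.
Proof.
case=> _ sg ug; apply/funext => p.
rewrite /eval_metric /eval_bivector /endoJ /sharp.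
rewrite trmx_mul trmxK trmx_inv sg !mulmxA mulmxKV//.
by rewrite -(mulmxA _ (g p) (invmx _)) mulmxV// mulmx1.
Qed.

(* sharp_{pi,xi} *)
Definition anchor (R : realType) (n : nat) (M : manifold R n)
    (pi : M -> 'M[R]_n) (xi : M -> 'rV[R]_n) (a : M -> 'cV[R]_n) :
    M -> 'rV[R]_n :=
  fun p => sharp_pi pi a p + pairing a xi p *: xi p.

(* [a, b]_pi *)
Definition koszul_bracket (R : realType) (n : nat) (M : manifold R n)
    (pi : M -> 'M[R]_n) (a b : M -> 'cV[R]_n) : M -> 'cV[R]_n :=
  fun p => lie_form (sharp_pi pi a) b p - lie_form (sharp_pi pi b) a p
           - differential (eval_bivector pi a b) p.

(* lambda = g(xi, xi) flat(xi) - flat(J xi) *)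
Definition lambda_form (R : realType) (n : nat) (M : manifold R n)
    (pi : M -> 'M[R]_n) (xi : M -> 'rV[R]_n) (g : M -> 'M[R]_n) :
    M -> 'cV[R]_n :=
  fun p => eval_metric g xi xi p *: flat g xi p - flat g (endoJ pi g xi) p.

(* [a, b]_{pi,xi}^g *)
Definition jacobi_bracket (R : realType) (n : nat) (M : manifold R n)
    (pi : M -> 'M[R]_n) (xi : M -> 'rV[R]_n) (g : M -> 'M[R]_n)
    (a b : M -> 'cV[R]_n) : M -> 'cV[R]_n :=
  fun p => koszul_bracket pi a b p
           + pairing a xi p *: (lie_form xi b p - b p)
           - pairing b xi p *: (lie_form xi a p - a p)
           - eval_bivector pi a b p *: lambda_form pi xi g p.

Definition almost_lie_algebroid (R : realType) (n : nat) (M : manifold R n)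
    (rho : (M -> 'cV[R]_n) -> (M -> 'rV[R]_n))
    (br : (M -> 'cV[R]_n) -> (M -> 'cV[R]_n) -> (M -> 'cV[R]_n)) : Prop :=
  forall a b, one_form a -> one_form b ->
    rho (br a b) = lie_bracket (rho a) (rho b).

Definition isometric_anchor (R : realType) (n : nat) (M : manifold R n)
    (g : M -> 'M[R]_n) (rho : (M -> 'cV[R]_n) -> (M -> 'rV[R]_n)) : Prop :=
  forall a b, one_form a -> one_form b ->
    eval_metric g (rho a) (rho b) = cometric g a b.

(* Only the values of D on smooth 1-forms are constrained. *)
Record contravariant_derivative (R : realType) (n : nat) (M : manifold R n)
    (rho : (M -> 'cV[R]_n) -> (M -> 'rV[R]_n))
    (D : (M -> 'cV[R]_n) -> (M -> 'cV[R]_n) -> (M -> 'cV[R]_n)) : Prop := {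
  cder_form : forall a b, one_form a -> one_form b -> one_form (D a b);
  cderDl : forall a a' b, one_form a -> one_form a' -> one_form b ->
    D (fun p => a p + a' p) b = (fun p => D a b p + D a' b p);
  cderDr : forall a b b', one_form a -> one_form b -> one_form b' ->
    D a (fun p => b p + b' p) = (fun p => D a b p + D a b' p);
  cderZl : forall f a b, smooth_fun f -> one_form a -> one_form b ->
    D (fun p => f p *: a p) b = (fun p => f p *: D a b p);
  cderZr : forall f a b, smooth_fun f -> one_form a -> one_form b ->
    D a (fun p => f p *: b p) =
    (fun p => f p *: D a b p + vf_act (rho a) f p *: b p) }.

Record contravariant_levi_civita (R : realType) (n : nat) (M : manifold R n)
    (pi : M -> 'M[R]_n) (xi : M -> 'rV[R]_n) (g : M -> 'M[R]_n)
    (D : (M -> 'cV[R]_n) -> (M -> 'cV[R]_n) -> (M -> 'cV[R]_n)) : Prop := {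
  clc_derivative : contravariant_derivative (anchor pi xi) D;
  clc_symmetric : forall a b, one_form a -> one_form b ->
    (fun p => D a b p - D b a p) = jacobi_bracket pi xi g a b;
  clc_metric : forall a b c, one_form a -> one_form b -> one_form c ->
    vf_act (anchor pi xi a) (cometric g b c) =
    (fun p => cometric g (D a b) c p + cometric g b (D a c) p) }.

Record affine_connection (R : realType) (n : nat) (M : manifold R n)
    (nabla : (M -> 'rV[R]_n) -> (M -> 'rV[R]_n) -> (M -> 'rV[R]_n)) :
    Prop := {
  conn_vf : forall X Y, vector_field X -> vector_field Y ->
    vector_field (nabla X Y);
  connDl : forall X X' Y, vector_field X -> vector_field X' ->
    vector_field Y ->
    nabla (fun p => X p + X' p) Y = (fun p => nabla X Y p + nabla X' Y p);
  connDr : forall X Y Y', vector_field X -> vector_field Y ->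
    vector_field Y' ->
    nabla X (fun p => Y p + Y' p) = (fun p => nabla X Y p + nabla X Y' p);
  connZl : forall f X Y, smooth_fun f -> vector_field X -> vector_field Y ->
    nabla (fun p => f p *: X p) Y = (fun p => f p *: nabla X Y p);
  connZr : forall f X Y, smooth_fun f -> vector_field X -> vector_field Y ->
    nabla X (fun p => f p *: Y p) =
    (fun p => f p *: nabla X Y p + vf_act X f p *: Y p) }.

Record levi_civita (R : realType) (n : nat) (M : manifold R n)
    (g : M -> 'M[R]_n)
    (nabla : (M -> 'rV[R]_n) -> (M -> 'rV[R]_n) -> (M -> 'rV[R]_n)) :
    Prop := {
  lc_connection : affine_connection nabla;
  lc_torsion_free : forall X Y, vector_field X -> vector_field Y ->
    (fun p => nabla X Y p - nabla Y X p) = lie_bracket X Y;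
  lc_metric : forall X Y Z, vector_field X -> vector_field Y ->
    vector_field Z ->
    vf_act X (eval_metric g Y Z) =
    (fun p => eval_metric g (nabla X Y) Z p + eval_metric g Y (nabla X Z) p) }.

(* Main.v *)
Require Import Defs.
From mathcomp Require Import all_boot all_order all_algebra.
From mathcomp Require Import all_classical all_reals all_analysis.
From mathcomp Require Import ring lra.

Set Implicit Arguments.
Unset Strict Implicit.
Unset Printing Implicit Defensive.

Import Order.TTheory GRing.Theory Num.Theory.
Import numFieldNormedType.Exports.

Local Open Scope classical_set_scope.
Local Open Scope ring_scope.

(* Write rho for the anchor and S(a, b, c) for
   g(rho (D_a b) - nabla_(rho a) (rho b), rho c). Since rho intertwines the
   brackets and both connections are torsion free, S is symmetric in a, b; since
   rho is an isometry and both connections are metric, S is skew in b, c. Hence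
   S = 0. Bump functions show that every covector at p is the value of a global
   1-form; so the isometry condition makes rho invertible at each point, and
   S = 0 forces rho (D_a b) = nabla_(rho a) (rho b). *)

(** * Calculus of smooth functions on open sets *)

Section SmoothOn.
Context (R : realType).

(** The first-order expansion of [f] at [x] is also one for [g], and uniqueness of the differential
    then gives ['d g x = 'd f x]. *)
Lemma near_eq_differentiable (V W : normedModType R) (f g : V -> W) (x : V) :
  {near x, f =1 g} -> differentiable f x -> differentiable g x.
Proof.
move=> fg df.
have E : g \o shift x = cst (g x) + 'd f x +o_ 0 id.
  apply/eqaddoP => e e0.
  have /eqaddoP/(_ e e0) := diff_locally df.
  have : \forall h \near (0 : V), f (h + x) = g (h + x).
    by apply: filterS ((nbhs0P _ _).1 fg) => h /=; rewrite addrC.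
  apply: filterS2 => h fgh; rewrite /= !fctE /= fgh.
  by rewrite (nbhs_singleton fg).
have dE := diff_unique (diff_continuous df) E.
apply/diff_locallyP; rewrite dE; split=> //.
exact: diff_continuous df.
Qed.

Lemma differentiable_mx (V : normedModType R) m n (f : V -> 'M[R]_(m, n)) x :
  (forall i j, differentiable (fun y => f y i j) x) -> differentiable f x.
Proof.
move=> df.
have -> : f = \sum_i \sum_j (fun y => f y i j *: delta_mx i j).
  apply/funext => y; rewrite fct_sumE [LHS]matrix_sum_delta.
  by apply: eq_bigr => i _; rewrite fct_sumE.
apply: differentiable_sum => i; apply: differentiable_sum => j.
exact: differentiableZl.
Qed.

Notation iterD f s := (foldr (fun v h => 'D_v h) f s).

Lemma eq_iterD (V W : normedModType R) (U : set V) (f g : V -> W) :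
  open U -> (forall x, U x -> f x = g x) ->
  forall s x, U x -> iterD f s x = iterD g s x.
Proof.
move=> oU fg; elim=> [|v s IH] x Ux /=; first exact: fg.
by apply: near_eq_derive; apply: filterS IH _; exact: open_nbhs_nbhs.
Qed.

Lemma eq_smooth_on (V W : normedModType R) (U : set V) (f g : V -> W) :
  open U -> (forall x, U x -> f x = g x) -> smooth_on U f -> smooth_on U g.
Proof.
move=> oU fg sf s x Ux.
apply: near_eq_differentiable (sf s x Ux).
by apply: filterS (eq_iterD oU fg s) _; exact: open_nbhs_nbhs.
Qed.

Lemma smooth_on_differentiable (V W : normedModType R) (U : set V)
  (f : V -> W) x : smooth_on U f -> U x -> differentiable f x.
Proof. by move=> sf Ux; exact: (sf [::]). Qed.

Lemma smooth_on_derive (V W : normedModType R) (U : set V) (f : V -> W) v :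
  smooth_on U f -> smooth_on U ('D_v f).
Proof. by move=> sf s x /(sf (rcons s v)); rewrite foldr_rcons. Qed.

Lemma smooth_on_cst (V W : normedModType R) (U : set V) (a : W) :
  smooth_on U (cst a).
Proof.
suff E s : exists b, iterD (cst a : V -> W) s = cst b.
  by move=> s x _; have [b ->] := E s; exact: differentiable_cst.
elim: s => [|v s [b /= ->]]; first by exists a.
by exists 0; apply/funext => x; rewrite derive_cst.
Qed.

(* Up to equality on U, this class is closed under directional derivatives,
   which is what makes all its members smooth. *)
Inductive smooth_expr (V : normedModType R) (U : set V) : (V -> R) -> Prop :=
| smooth_expr_base f : smooth_on U f -> smooth_expr U f
| smooth_expr_add f g : smooth_expr U f -> smooth_expr U g ->
    smooth_expr U (f + g)
| smooth_expr_mul f g : smooth_expr U f -> smooth_expr U g ->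
    smooth_expr U (f * g)
| smooth_expr_comp (h : R -> R) f : smooth_on setT h -> smooth_expr U f ->
    smooth_expr U (h \o f).

(** Sum, Leibniz and chain rules express the derivative of each constructor within the class. The
    equality is claimed on [U] only, since base functions are controlled only there. *)
Lemma smooth_expr_derive (V : normedModType R) (U : set V) (f : V -> R) :
  smooth_expr U f ->
  (forall x, U x -> differentiable f x) /\
  (forall v, exists2 g, smooth_expr U g & forall x, U x -> 'D_v f x = g x).
Proof.
elim=> {f} [f sf|f g _ [df Df] _ [dg Dg]|f g ef [df Df] eg [dg Dg]
  |h f sh ef [df Df]].
- split=> [x|v]; first exact: smooth_on_differentiable.
  by exists ('D_v f) => //; apply/smooth_expr_base/smooth_on_derive.
- split=> [x Ux|v]; first by apply: differentiableD; [exact: df|exact: dg].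
  have [f' ef' f'E] := Df v; have [g' eg' g'E] := Dg v.
  exists (f' + g'); first exact: smooth_expr_add.
  move=> x Ux; rewrite deriveD; [|exact/diff_derivable/df|exact/diff_derivable/dg].
  by rewrite f'E// g'E.
- split=> [x Ux|v]; first by apply: differentiableM; [exact: df|exact: dg].
  have [f' ef' f'E] := Df v; have [g' eg' g'E] := Dg v.
  exists (f * g' + g * f').
    by apply: smooth_expr_add; apply: smooth_expr_mul.
  move=> x Ux; rewrite deriveM; [|exact/diff_derivable/df|exact/diff_derivable/dg].
  by rewrite f'E// g'E.
- have dh y : differentiable h y by exact: smooth_on_differentiable sh _.
  split=> [x Ux|v]; first by apply: differentiable_comp; [exact: df|exact: dh].
  have [f' ef' f'E] := Df v.
  exists (f' * ('D_1 h \o f)).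
    apply: smooth_expr_mul => //; apply: smooth_expr_comp => //.
    exact: smooth_on_derive.
  (* The differential of [h] on the line is multiplication by ['D_1 h]: its argument is written as a
     multiple of 1 and pulled out by linearity. *)
  move=> x Ux; have dfx := df x Ux; rewrite deriveE;
    last exact: differentiable_comp.
  rewrite diff_comp// /= -(deriveE _ dfx) f'E// -[X in 'd _ _ X]mulr1.
  by rewrite [LHS]linearZ /= -deriveE.
Qed.

(** The induction removes the last direction of the list, which is the innermost derivative; on [U]
    it agrees with another member of the class. *)
Lemma smooth_expr_on (V : normedModType R) (U : set V) (f : V -> R) :
  open U -> smooth_expr U f -> smooth_on U f.
Proof.
move=> oU + s; elim/last_ind: s f => [|s v IH] f ef x Ux.
  exact: (smooth_expr_derive ef).1.
rewrite foldr_rcons.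
have [g eg gE] := (smooth_expr_derive ef).2 v.
apply: near_eq_differentiable (IH _ eg x Ux).
apply: filterS (open_nbhs_nbhs (conj oU Ux)).
by apply: eq_iterD => // y Uy; rewrite gE.
Qed.

Lemma smooth_onD (V : normedModType R) (U : set V) (f g : V -> R) :
  open U -> smooth_on U f -> smooth_on U g -> smooth_on U (f + g).
Proof.
move=> oU sf sg; apply: smooth_expr_on => //.
by apply: smooth_expr_add; exact: smooth_expr_base.
Qed.

Lemma smooth_onM (V : normedModType R) (U : set V) (f g : V -> R) :
  open U -> smooth_on U f -> smooth_on U g -> smooth_on U (f * g).
Proof.
move=> oU sf sg; apply: smooth_expr_on => //.
by apply: smooth_expr_mul; exact: smooth_expr_base.
Qed.

Lemma smooth_on_comp (V : normedModType R) (U : set V) (h : R -> R)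
    (f : V -> R) :
  open U -> smooth_on setT h -> smooth_on U f -> smooth_on U (h \o f).
Proof.
move=> oU sh sf; apply: smooth_expr_on => //.
by apply: smooth_expr_comp => //; exact: smooth_expr_base.
Qed.

Lemma smooth_on_sum (V : normedModType R) (U : set V) (I : Type) (r : seq I)
    (f : I -> V -> R) :
  open U -> (forall i, smooth_on U (f i)) ->
  smooth_on U (fun x => \sum_(i <- r) f i x).
Proof.
move=> oU sf; elim: r => [|i r IH].
  by under eq_fun do rewrite big_nil; exact: smooth_on_cst.
by under eq_fun do rewrite big_cons; exact: smooth_onD.
Qed.

(** Iterated derivatives commute with taking entries on [U]. This reduces matrix-valued smoothness
    to the scalar case, where [smooth_expr] applies. *)
Lemma smooth_on_mxP (V : normedModType R) m n (U : set V)
    (f : V -> 'M[R]_(m, n)) : open U ->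
  smooth_on U f <-> (forall i j, smooth_on U (fun x => f x i j)).
Proof.
move=> oU; split=> [sf i j s x Ux|sf].
  have E t y : U y -> iterD (fun z => f z i j) t y = iterD f t y i j.
    elim: t y => [//|v t IH] y Uy /=.
    rewrite (@near_eq_derive _ _ _ _ (fun z => iterD f t z i j)).
      rewrite derive_mx ?mxE//; exact/diff_derivable/sf.
    by apply: filterS (open_nbhs_nbhs (conj oU Uy)).
  apply: (@near_eq_differentiable _ _ (fun z => iterD f s z i j)).
    by apply: filterS (open_nbhs_nbhs (conj oU Ux)) => y /E ->.
  apply: (@differentiable_comp _ _ _ _ (iterD f s) (fun N => N i j)).
    exact: sf.
  exact: differentiable_coord.
have E s x : U x -> iterD f s x = \matrix_(i, j) iterD (fun z => f z i j) s x.
  elim: s x => [|v s IH] x Ux /=; first by apply/matrixP => i j; rewrite mxE.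
  rewrite (@near_eq_derive _ _ _ _
    (fun z => \matrix_(i, j) iterD (fun z => f z i j) s z)); last first.
    by apply: filterS (open_nbhs_nbhs (conj oU Ux)).
  rewrite derive_mx.
    apply/matrixP => i j; rewrite !mxE; congr ('D_v _ _).
    by apply/funext => z; rewrite mxE.
  apply/derivable_mxP => i j; under eq_fun do rewrite mxE.
  exact/diff_derivable/sf.
move=> s x Ux; apply: (@near_eq_differentiable _ _
    (fun z => \matrix_(i, j) iterD (fun z => f z i j) s z)).
  by apply: filterS (open_nbhs_nbhs (conj oU Ux)) => y /E ->.
by apply: differentiable_mx => i j; under eq_fun do rewrite mxE; exact: sf.
Qed.

Lemma smooth_on_mulmx (V : normedModType R) m n p (U : set V)
    (f : V -> 'M[R]_(m, n)) (g : V -> 'M[R]_(n, p)) : open U ->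
  smooth_on U f -> smooth_on U g -> smooth_on U (fun x => f x *m g x).
Proof.
move=> oU /(smooth_on_mxP _ oU) sf /(smooth_on_mxP _ oU) sg.
apply/smooth_on_mxP => // i j; under eq_fun do rewrite mxE.
by apply: smooth_on_sum => // k; apply: smooth_onM.
Qed.

Lemma smooth_on_trmx (V : normedModType R) m n (U : set V)
    (f : V -> 'M[R]_(m, n)) : open U ->
  smooth_on U f -> smooth_on U (fun x => (f x)^T).
Proof.
move=> oU /(smooth_on_mxP _ oU) sf.
by apply/smooth_on_mxP => // i j; under eq_fun do rewrite mxE; exact: sf.
Qed.

Lemma smooth_on_addmx (V : normedModType R) m n (U : set V)
    (f g : V -> 'M[R]_(m, n)) : open U ->
  smooth_on U f -> smooth_on U g -> smooth_on U (fun x => f x + g x).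
Proof.
move=> oU /(smooth_on_mxP _ oU) sf /(smooth_on_mxP _ oU) sg.
by apply/smooth_on_mxP => // i j; under eq_fun do rewrite mxE;
  exact: smooth_onD.
Qed.

Lemma smooth_on_scalemx (V : normedModType R) m n (U : set V)
    (k : V -> R) (f : V -> 'M[R]_(m, n)) : open U ->
  smooth_on U k -> smooth_on U f -> smooth_on U (fun x => k x *: f x).
Proof.
move=> oU sk /(smooth_on_mxP _ oU) sf.
by apply/smooth_on_mxP => // i j; under eq_fun do rewrite mxE;
  exact: smooth_onM.
Qed.

Lemma smooth_on_jacobian m n (U : set 'rV[R]_m) (f : 'rV[R]_m -> 'rV[R]_n) :
  open U -> smooth_on U f -> smooth_on U (fun x => 'J f x).
Proof.
move=> oU sf; apply/smooth_on_mxP => // i j.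
have := smooth_on_derive (delta_mx 0 i) sf.
move=> /(smooth_on_mxP _ oU)/(_ 0 j); apply: eq_smooth_on => // x Ux.
rewrite deriveEjacobian; last exact: smooth_on_differentiable sf Ux.
by rewrite -rowE mxE.
Qed.

End SmoothOn.

(** * A smooth function on the line that is flat at 0 *)

Section FlatFunction.
Context (R : realType).

(* [flat_exp 1] is exp (-1/t) extended by 0 for t <= 0; its derivatives are
   the [flat_exp p], p a polynomial in 1/t. *)
Definition flat_exp (p : {poly R}) (t : R) : R :=
  if 0 < t then p.[t^-1] * expR (- t^-1) else 0.

(** A single term of the exponential series is at most its sum; degree 0 is treated apart. *)
Lemma expr_le_fact_expR (u : R) k : 0 <= u -> u ^+ k <= k`!%:R * expR u.
Proof.
move=> u0; case: k => [|k]; first by rewrite expr0 fact0 mul1r -expR0 ler_expR.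
rewrite mulrC -ler_pdivrMr ?ltr0n ?fact_gt0//.
by apply: le_trans (expR_ge1Dxn k u0); rewrite lerDr.
Qed.

Lemma horner_le_expR (p : {poly R}) :
  exists C, forall u, 0 <= u -> `|p.[u]| <= C * expR u.
Proof.
exists (\sum_(i < size p) `|p`_i| * i`!%:R) => u u0.
rewrite horner_coef mulr_suml; apply: le_trans (ler_norm_sum _ _ _) _.
apply: ler_sum => i _; rewrite normrM -mulrA ler_wpM2l//.
by rewrite ger0_norm ?exprn_ge0// expr_le_fact_expR.
Qed.

Lemma flat_exp_le (p : {poly R})
  : exists C, forall t, `|flat_exp p t| <= C * t ^+ 2.
Proof.
(* At [u = t^-1] the extra factor ['X^2] equals [t^-2]; moved to the other side it becomes the
   [t ^+ 2] of the bound. *)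
have [C HC] := horner_le_expR (p * 'X^2).
have C0 : 0 <= C.
  by have := HC 0 (lexx _); rewrite expR0 mulr1; apply: le_trans.
exists C => t; rewrite /flat_exp; case: ltP => [t0|_]; last first.
  by rewrite normr0 mulr_ge0// sqr_ge0.
have u0 : 0 <= t^-1 by rewrite invr_ge0 ltW.
have := HC _ u0; rewrite hornerM hornerXn exprVn expRN.
rewrite !normrM !(@ger0_norm _ (_^-1)) ?invr_ge0 ?expR_ge0 ?sqr_ge0//.
rewrite ler_pdivrMr ?exprn_gt0// ler_pdivrMr ?expR_gt0//.
by rewrite mulrAC.
Qed.

(** For [t > 0], differentiating [p(1/t) exp(-1/t)] brings out [t^-2] times [p - p'] at [1/t]. At 0
    the quadratic bound forces the derivative to vanish. *)
Lemma is_derive_flat_exp (p : {poly R}) (t : R) :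
  is_derive t (1 : R) (flat_exp p) (flat_exp ((p - p^`()) * 'X^2) t).
Proof.
have [t0|t0|<-] := ltgtP 0 t.
- have nt : {near t, (fun s => p.[s^-1] * expR (- s^-1)) =1 flat_exp p}.
    near=> s; rewrite /flat_exp ifT//; near: s; exact: lt_nbhsr.
  apply: near_eq_is_derive nt _.
  have tn : t != 0 by rewrite gt_eqF.
  have dV : is_derive t 1 (fun s : R => s^-1) (- t ^- 2).
    have := is_deriveV tn (is_derive_id t (1 : R)).
    by rewrite /GRing.scale/= mulr1.
  have dE : is_derive t 1 (fun s : R => expR (- s^-1)) (expR (- t^-1) * t ^- 2).
    have := @is_derive1_comp _ expR (fun s =>
      - s^-1) t _ _ (is_derive_expR _) (is_deriveN dV).
    by rewrite opprK.
  have dP : is_derive t 1 (fun s : R => p.[s^-1]) (p^`().[t^-1] * - t ^- 2).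
    exact: (@is_derive1_comp _ (horner p) (fun s => s^-1)
      t _ _ (is_derive_poly _ _) dV).
  have := is_deriveM dP dE; congr (is_derive _ _ _ _).
  rewrite /flat_exp t0 /GRing.scale/= hornerM hornerD hornerN hornerXn exprVn;
    ring.
- apply: (@near_eq_is_derive _ _ _ (cst 0)).
    near=> s; rewrite /flat_exp ltNge ifF//; apply/negbTE; rewrite negbK ltW//.
    near: s; exact: lt_nbhsl.
  by rewrite /flat_exp ltNge ltW//=; exact: is_derive_cst.
- rewrite {2}/flat_exp ltxx.
  have [C HC] := flat_exp_le p.
  have cv : (fun h : R => h^-1 *: ((flat_exp p \o shift 0) (h *: 1)
    - flat_exp p 0)) @ 0^'
      --> (0 : R).
    rewrite {2}/flat_exp ltxx.
    apply/norm_cvg0P.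
    (* Dividing the bound [C * h ^+ 2] by [|h|] leaves [C * |h|], which tends to 0. *)
    apply: (@squeeze_cvgr _ _ _ _ (cst 0) (fun h : R => C * `|h|)).
    + near=> h; rewrite normr_ge0/= addr0 subr0
      /GRing.scale/= mulr1 normrM normfV.
      have h0 : 0 < `|h| by rewrite normr_gt0; near: h; exact: nbhs_dnbhs_neq.
      rewrite mulrC ler_pdivrMr// -mulrA -expr2 -normrX.
      by rewrite (ger0_norm (sqr_ge0 _)).
    + exact: cvg_cst.
    + have : C * `|h| @[h --> (0 : R)^'] --> C * `|0 : R|.
        apply: cvgMl_tmp; apply: cvg_norm.
        by apply: cvg_within_filter; exact: cvg_id.
      by rewrite normr0 mulr0.
  split; first by apply/cvg_ex; exists 0.
  exact: cvg_lim cv.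
Unshelve. all: by end_near. Qed.

Lemma smooth_flat_exp (p : {poly R}) : smooth_on setT (flat_exp p).
Proof.
move=> s; elim/last_ind: s p => [|s v IH] p x _ /=.
  by apply/derivable1_diffP; have [] := is_derive_flat_exp p x.
rewrite foldr_rcons.
(* On the line a direction [v] is a scalar, absorbed here into the polynomial, so the family is
   stable under every ['D_v]. *)
have -> : 'D_v (flat_exp p) = flat_exp (v *: ((p - p^`()) * 'X^2)).
  apply/funext => t.
  have [d dE] := is_derive_flat_exp p t.
  rewrite deriveE; last exact/derivable1_diffP.
  rewrite -[X in 'd _ _ X]mulr1 [LHS]linearZ /= -deriveE;
    last exact/derivable1_diffP.
  rewrite dE /flat_exp; case: ifP => _; last by rewrite scaler0.
  by rewrite hornerZ -mulrA.
exact: IH.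
Qed.

Lemma flat_exp1_gt0 (t : R) : 0 < t -> 0 < flat_exp 1 t.
Proof. by move=> t0; rewrite /flat_exp t0 hornerE mul1r expR_gt0. Qed.

Lemma flat_exp_le0 p (t : R) : t <= 0 -> flat_exp p t = 0.
Proof. by move=> t0; rewrite /flat_exp ltNge t0. Qed.

End FlatFunction.

(** * Changes of charts, smoothness of the anchor, and extension of covectors *)

Section Charts.
Context (R : realType).

Lemma jacobian_comp m n p (f : 'rV[R]_m -> 'rV[R]_n) (g : 'rV[R]_n -> 'rV[R]_p)
    x : differentiable f x -> differentiable g (f x) ->
  'J (g \o f) x = 'J f x *m 'J g (f x).
Proof.
move=> df dg; apply/row_matrixP => i.
by rewrite [LHS]rowE [RHS]rowE mulmxA !mul_rV_lin1 /= diff_comp.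
Qed.

Lemma near_eq_jacobian m n (f g : 'rV[R]_m -> 'rV[R]_n) x :
  {near x, f =1 g} -> differentiable f x -> 'J g x = 'J f x.
Proof.
move=> fg df; have dg := near_eq_differentiable fg df.
apply/row_matrixP => i; rewrite [LHS]rowE [RHS]rowE.
apply: etrans (deriveEjacobian _ df);
  apply: etrans (esym (deriveEjacobian _ dg)) _.
by apply: near_eq_derive; apply: filterS fg => y ->.
Qed.

Lemma jacobian_id n (x : 'rV[R]_n) : 'J id x = 1%:M.
Proof.
apply/row_matrixP => i; rewrite [LHS]rowE [RHS]rowE mulmx1.
by rewrite -deriveEjacobian// derive_id.
Qed.

Lemma chart_image_open n (T : topologicalType) (c : chart R n T) (O : set T) :
  open O -> open (chart_to c @` (chart_dom c `&` O)).
Proof.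
move=> oO; rewrite openE => _ [q [cq Oq] <-].
have img : (chart_to c @` chart_dom c) (chart_to c q) by exists q.
have nO : nbhs (chart_to c q) (chart_of c @^-1` O).
  apply: (chart_of_cont (mem_set img)); rewrite chart_toK//.
  exact: open_nbhs_nbhs.
have nI := open_nbhs_nbhs (conj (@chart_img_open _ _ _ c) img).
apply: (@filterS2 _ (nbhs (chart_to c q)) _ _ _ _ _ nO nI).
by move=> y /= + [q' cq' yE]; rewrite -yE chart_toK// => Oq'; exists q'.
Qed.

Arguments chart_image_open {n T} c {O}.

Variables (n : nat) (M : manifold R n).
Implicit Types (c : chart R n M) (q : M).

Lemma chart_at_atlas q : atlas (chart_at q).
Proof. exact: s2valP (cid2 (atlas_cover q)). Qed.

Lemma chart_at_dom q : chart_dom (chart_at q) q.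
Proof. exact: s2valP' (cid2 (atlas_cover q)). Qed.

Hint Resolve chart_at_atlas chart_at_dom : core.

Lemma transition_differentiable c c' q : atlas c -> atlas c' ->
  chart_dom c q -> chart_dom c' q ->
  differentiable (transition c c') (chart_to c q).
Proof.
move=> ac ac' cq c'q.
by apply: smooth_on_differentiable (atlas_compat ac ac') _; exists q.
Qed.

(** This is the chain rule. The composite of transitions agrees with the direct one on the image of
    the overlap of [c1] and [c2], an open set, which suffices for Jacobians. *)
Lemma jacobian_transition_cocycle c1 c2 c3 q :
  atlas c1 -> atlas c2 -> atlas c3 ->
  chart_dom c1 q -> chart_dom c2 q -> chart_dom c3 q ->
  'J (transition c1 c2) (chart_to c1 q) *m 'J (transition c2 c3) (chart_to c2 q)
  = 'J (transition c1 c3) (chart_to c1 q).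
Proof.
move=> a1 a2 a3 d1 d2 d3.
have E : transition c1 c2 (chart_to c1 q) = chart_to c2 q.
  by rewrite /transition /= chart_toK.
rewrite -{1}E -jacobian_comp ?E; [|exact: transition_differentiable..].
apply: near_eq_jacobian; last exact: transition_differentiable.
have := open_nbhs_nbhs (conj (chart_image_open c1 (@chart_dom_open _ _ _ c2))
  (ex_intro2 _ _ q (conj d1 d2) erefl)).
by apply: filterS => _ [q' [d1' d2'] <-]; rewrite /transition /= !chart_toK.
Qed.

Lemma jacobian_transition_refl c q : chart_dom c q ->
  'J (transition c c) (chart_to c q) = 1%:M.
Proof.
move=> cq; rewrite -(jacobian_id (chart_to c q)); apply: near_eq_jacobian => //.
have := open_nbhs_nbhs (conj (@chart_img_open _ _ _ c)
  (ex_intro2 _ _ q cq erefl)).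
by apply: filterS => _ [q' cq' <-]; rewrite /transition /= chart_toK.
Qed.

Lemma jac_from_toK c q : atlas c -> chart_dom c q ->
  jac_from c q *m jac_to c q = 1%:M.
Proof.
move=> ac cq; rewrite /jac_from /jac_to jacobian_transition_cocycle//.
exact: jacobian_transition_refl.
Qed.

(** The anchor is tensorial: in any chart of the atlas its components are given by the same formula
    in those of [a], [pi] and [xi], because the Jacobians cancel by [jac_from_toK]. *)
Lemma anchor_vector_field (pi : M -> 'M[R]_n) (xi : M -> 'rV[R]_n)
    (a : M -> 'cV[R]_n) :
  bivector_field pi -> vector_field xi -> one_form a ->
  vector_field (anchor pi xi a).
Proof.
move=> [spi _] sxi sa c ac; have oU := @chart_img_open _ _ _ c.
apply: (@eq_smooth_on _ _ _ _ (fun x =>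
  (form_in c a x)^T *m bivector_in c pi x
  + (vf_in c xi x *m form_in c a x) 0 0 *: vf_in c xi x)) => //.
  move=> _ [q cq <-]; rewrite /form_in /bivector_in /vf_in /anchor /sharp_pi
    /pairing chart_toK// trmx_mul.
  move: (jac_from c q) (jac_to c q) (jac_from_toK ac cq) => F G FG.
  have GF : G^T *m F^T = 1%:M by rewrite -trmx_mul FG trmx1.
  rewrite mulmxDl -scalemxAl; congr (_ + _ *: _).
    by rewrite -!mulmxA [G^T *m (F^T *m _)]mulmxA GF mul1mx.
  by rewrite -mulmxA [F *m (G *m _)]mulmxA FG mul1mx.
apply: smooth_on_addmx => //.
  apply: smooth_on_mulmx => //; last exact: spi.
  by apply: smooth_on_trmx => //; exact: sa.
apply: smooth_on_scalemx => //; last exact: sxi.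
have : smooth_on (chart_to c @` chart_dom c)
    (fun x => vf_in c xi x *m form_in c a x).
  by apply: smooth_on_mulmx => //; [exact: sxi|exact: sa].
by move/(smooth_on_mxP _ oU); apply.
Qed.

(** The form with constant components [w] in [chart_at p] is cut off by a bump function and extended
    by zero. *)
Lemma one_form_extension (p : M) (w : 'cV[R]_n) :
  exists2 a : M -> 'cV[R]_n, one_form a & a p = w.
Proof.
pose c := chart_at p; have ac : atlas c by exact: chart_at_atlas.
pose x0 := chart_to c p.
have dp : chart_dom c p by exact: chart_at_dom.
(* The radius is halved so that the closed cube fits in an open ball inside the chart image. *)
have [r r0 rimg] : exists2 r : R, 0 < r & forall x : 'rV[R]_n,
    (forall i, `|x 0 i - x0 0 i| <= r) -> (chart_to c @` chart_dom c) x.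
  have /nbhs_ballP[e /= e0 eimg] := open_nbhs_nbhs
    (conj (@chart_img_open _ _ _ c) (ex_intro2 _ _ p dp erefl)).
  exists (e / 2) => [|x xr]; first by rewrite divr_gt0.
  apply: eimg; split=> // i j; rewrite ord1 /ball /= distrC.
  by apply: le_lt_trans (xr j) _; rewrite gtr_pMr// invf_lt1// ltr1n.
(* The bump is nonzero only in the Euclidean ball of radius [r], which lies in the cube. The squared
   Euclidean distance is used because it is smooth. *)
pose phi (x : 'rV[R]_n) : R :=
  flat_exp 1 (r ^+ 2 - \sum_i (x 0 i - x0 0 i) ^+ 2).
have phi_supp x : phi x != 0 -> forall i, `|x 0 i - x0 0 i| <= r.
  move=> /eqP phix i; rewrite leNgt; apply/negP => ri; apply: phix.
  apply: flat_exp_le0; rewrite subr_le0.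
  rewrite (bigD1 i)//= -[leLHS]addr0 lerD//.
    by rewrite -[leRHS]real_normK ?num_real// lerXn2r ?nnegrE// ?ltW.
  by apply: sumr_ge0 => j _; exact: sqr_ge0.
have phi0 : phi x0 != 0.
  rewrite gt_eqF// flat_exp1_gt0// big1 ?subr0 ?exprn_gt0// => i _.
  by rewrite subrr expr0n.
pose K := [set x : 'rV[R]_n | forall i, `|x 0 i - x0 0 i| <= r].
have cK : compact K.
  have := @rV_compact _ n (fun i => `[x0 0 i - r, x0 0 i + r]%classic)
    (fun i => @segment_compact _ _ _).
  congr compact; apply/funext => x; apply/propext; split => /= xK i;
    by have := xK i; rewrite in_itv/= ler_distl.
(* The compact image of the cube is closed because [M] is Hausdorff; the extension by zero is thus
   smooth at points outside the chart. *)
have cKM : closed (chart_of c @` K).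
  apply: compact_closed; first exact: manifold_hausdorff.
  apply: continuous_compact => //.
  apply: continuous_in_subspaceT => x /set_mem xK.
  exact/chart_of_cont/mem_set/rimg.
(* Dividing by [phi x0] makes the cutoff 1 at [p]; [jac_from c q] turns components in [c] into
   components in [chart_at q]. *)
pose a q := if `[< chart_dom c q >]
  then (phi (chart_to c q) / phi x0) *: (jac_from c q *m w) else 0.
have aE q : chart_dom c q ->
    a q = (phi (chart_to c q) / phi x0) *: (jac_from c q *m w).
  by move=> cq; rewrite /a asboolT.
have aK q : ~ (chart_of c @` K) q -> a q = 0.
  move=> qK; rewrite /a; case: asboolP => // cq.
  have -> : phi (chart_to c q) = 0; last by rewrite mul0r scale0r.
  apply/eqP/negPn/negP => /phi_supp pq; apply: qK.
  by exists (chart_to c q) => //; rewrite chart_toK.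
exists a; last first.
  rewrite aE// divff// scale1r /jac_from -/c jacobian_transition_refl//.
  by rewrite mul1mx.
move=> c' ac' s _ [q c'q <-].
have [cq|cq] := pselect (chart_dom c q); last first.
  have oU := chart_image_open c' (closed_openC cKM).
  apply: (eq_smooth_on oU _ (smooth_on_cst (U := _) 0)).
    move=> _ [q' [c'q' Kq'] <-].
    by rewrite /form_in chart_toK// aK// mulmx0.
  exists q => //; split=> // -[x xK xq]; apply: cq.
  by rewrite -xq; have [q' cq' <-] := rimg _ xK; rewrite chart_toK.
have oU := chart_image_open c' (@chart_dom_open _ _ _ c).
have sT := atlas_compat ac' ac.
(* The charts [chart_at q'] may vary erratically with [q'], but the cocycle identity eliminates
   them, leaving only the smooth transition from [c'] to [c]. *)
apply: (@eq_smooth_on _ _ _ _ (fun y => (phi (transition c' c y) / phi x0) *: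
  ('J (transition c' c) y *m w)) _ oU); last by exists q.
  move=> _ [q' [c'q' cq'] <-].
  have TE : transition c' c (chart_to c' q') = chart_to c q'.
    by rewrite /transition /= chart_toK.
  have JE := jacobian_transition_cocycle ac' (chart_at_atlas q') ac
    c'q' (chart_at_dom q') cq'.
  by rewrite TE -JE /form_in chart_toK// aE// -scalemxAr mulmxA.
apply: smooth_on_scalemx => //; last first.
  apply: smooth_on_mulmx => //; last exact: smooth_on_cst.
  exact: smooth_on_jacobian.
apply: smooth_onM => //; last exact: smooth_on_cst.
apply: smooth_on_comp => //; first exact: smooth_flat_exp.
apply: smooth_onD => //; first exact: smooth_on_cst.
have -> : (fun x => - \sum_i (transition c' c x 0 i - x0 0 i) ^+ 2) =
    (fun x => \sum_i (transition c' c x 0 i - x0 0 i) *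
                     (-1 * (transition c' c x 0 i - x0 0 i))).
  apply/funext => x; rewrite -sumrN; apply: eq_bigr => i _; ring.
move/(smooth_on_mxP _ oU) : sT => sT.
have sB i : smooth_on (chart_to c' @` (chart_dom c' `&` chart_dom c))
    (fun x => transition c' c x 0 i - x0 0 i).
  by apply: smooth_onD => //; exact: smooth_on_cst.
apply: smooth_on_sum => // i; apply: smooth_onM => //.
by apply: smooth_onM => //; exact: smooth_on_cst.
Qed.

End Charts.

(** * Pointwise linear algebra of the metric and the anchor *)

Section MetricAlgebra.
Context (R : realType) (n : nat) (M : manifold R n).

Lemma anchorE (pi : M -> 'M[R]_n) (xi : M -> 'rV[R]_n) (a : M -> 'cV[R]_n) p :
  anchor pi xi a p = (a p)^T *m (pi p + (xi p)^T *m xi p).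
Proof.
rewrite /anchor /sharp_pi /pairing mulmxDr mulmxA; congr (_ + _).
rewrite -mul_scalar_mx; congr (_ *m _).
by rewrite -mx11_scalar -trmx_mul; apply/matrixP => i j; rewrite !ord1 [RHS]mxE.
Qed.

Lemma cometricE (g : M -> 'M[R]_n) (a b : M -> 'cV[R]_n) p :
  pseudo_riemannian g ->
  cometric g a b p = ((a p)^T *m invmx (g p) *m b p) 0 0.
Proof.
case=> _ sg ug; rewrite /cometric /eval_metric /sharp mulmxKV//.
by rewrite trmx_mul trmxK trmx_inv sg mulmxA.
Qed.

Lemma mx_bilinear_eq0 (A : 'M[R]_n) :
  (forall u v : 'cV[R]_n, (u^T *m A *m v) 0 0 = 0) -> A = 0.
Proof.
move=> A0; apply/matrixP => i j; rewrite mxE.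
rewrite -(A0 (delta_mx i 0) (delta_mx j 0)) trmx_delta -rowE.
by rewrite -colE !mxE.
Qed.

(** Tested on all covectors at [p], the isometry condition reads [A g A^T = g^-1] for the matrix [A]
    of the anchor. The right side is invertible, hence so is the square factor [A]. *)
Lemma anchor_unit (pi g : M -> 'M[R]_n) (xi : M -> 'rV[R]_n) p :
  pseudo_riemannian g -> isometric_anchor g (anchor pi xi) ->
  pi p + (xi p)^T *m xi p \in unitmx.
Proof.
move=> gP iso; set A := pi p + _.
have E : A *m g p *m A^T = invmx (g p).
  apply/eqP; rewrite -subr_eq0; apply/eqP/mx_bilinear_eq0 => u v.
  have [a fa <-] := one_form_extension p u.
  have [b fb <-] := one_form_extension p v.
  have := congr1 (@^~ p) (iso a b fa fb).
  rewrite cometricE// /eval_metric !anchorE trmx_mul trmxK !mulmxA => H.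
  by rewrite mulmxBr mulmxBl !mulmxA mxE [X in _ + X]mxE H subrr.
have [_ _ ug] := gP.
have : invmx (g p) \in unitmx by rewrite unitmx_inv.
by rewrite -E -mulmxA unitmx_mul => /andP[].
Qed.

(** At each point [X - Y] is annihilated by the invertible matrix [g A^T], as seen on forms whose
    values at the point are the basis covectors. *)
Lemma eq_of_metric_anchor (pi g : M -> 'M[R]_n) (xi X Y : M -> 'rV[R]_n) :
  pseudo_riemannian g -> isometric_anchor g (anchor pi xi) ->
  (forall c, one_form c ->
    eval_metric g X (anchor pi xi c) = eval_metric g Y (anchor pi xi c)) ->
  X = Y.
Proof.
move=> gP iso XY; apply/funext => p.
have uA := anchor_unit p gP iso; have [_ _ ug] := gP.
suff : (X p - Y p) *m (g p *m (pi p + (xi p)^T *m xi p)^T) = 0.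
  move/(congr1 (mulmx^~ (invmx (g p *m (pi p + (xi p)^T *m xi p)^T)))).
  rewrite mul0mx mulmxK; first by move/eqP; rewrite subr_eq0 => /eqP.
  by rewrite unitmx_mul ug unitmx_tr.
apply/rowP => i; rewrite [RHS]mxE.
have [c fc cE] := one_form_extension p (delta_mx i 0).
have := congr1 (@^~ p) (XY c fc); rewrite /eval_metric anchorE cE.
rewrite trmx_mul trmxK !mulmxA -colE [X in X = _ -> _]mxE.
rewrite -[X in _ = X -> _]/(_ 0 0) -colE [X in _ = X -> _]mxE.
by move=> H; rewrite !mulmxBl mxE [X in _ + X]mxE H subrr.
Qed.

End MetricAlgebra.

(** * Comparison of the two Levi-Civita derivatives *)

Lemma sym_skew_eq0 (R : realType) (T : Type) (P : T -> Prop) (S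
  : T -> T -> T -> R) :
  (forall a b c, P a -> P b -> P c -> S a b c = S b a c) ->
  (forall a b c, P a -> P b -> P c -> S a b c = - S a c b) ->
  forall a b c, P a -> P b -> P c -> S a b c = 0.
Proof.
move=> sym skew a b c Pa Pb Pc.
(* Alternating the two symmetries gives [S a b c = - S a c b = - S c a b = S c b a = S b c a = - S b
   a c = - S a b c]. *)
have E : S a b c = - S a b c.
  rewrite {1}skew// sym// skew// opprK sym// skew//; congr (- _); exact: sym.
lra.
Qed.

Theorem proposition2p1 (R : realType) (n : nat) (M : manifold R n)
    (pi : M -> 'M[R]_n) (xi : M -> 'rV[R]_n) (g : M -> 'M[R]_n)
    (D : (M -> 'cV[R]_n) -> (M -> 'cV[R]_n) -> (M -> 'cV[R]_n))
    (nabla : (M -> 'rV[R]_n) -> (M -> 'rV[R]_n) -> (M -> 'rV[R]_n))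
    (pi_bivector : bivector_field pi)
    (xi_vector : vector_field xi)
    (g_metric : pseudo_riemannian g)
    (almost_lie :
      almost_lie_algebroid (anchor pi xi) (jacobi_bracket pi xi g))
    (isometry : isometric_anchor g (anchor pi xi))
    (D_levi_civita : contravariant_levi_civita pi xi g D)
    (nabla_levi_civita : levi_civita g nabla) :
  forall alpha beta : M -> 'cV[R]_n, one_form alpha -> one_form beta ->
    anchor pi xi (D alpha beta) =
    nabla (anchor pi xi alpha) (anchor pi xi beta).
Proof.
move=> alpha beta falpha fbeta.
pose rho := anchor pi xi.
have rhovf a : one_form a -> vector_field (rho a) by exact: anchor_vector_field.
have [Dd Dsym Dmet] := D_levi_civita.
have Dform := cder_form Dd.
have [_ Ntor Nmet] := nabla_levi_civita.
apply: (eq_of_metric_anchor g_metric isometry) => c fc; apply/funext => p.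
pose S a b c := eval_metric g (rho (D a b)) (rho c) p
                - eval_metric g (nabla (rho a) (rho b)) (rho c) p.
suff : S alpha beta c = 0 by move/eqP; rewrite subr_eq0 => /eqP.
apply: (sym_skew_eq0 (P := @one_form R n M) (S := S)) => //
  {alpha beta c falpha fbeta fc} a b c fa fb fc.
(* Symmetry in [a], [b]: the anchor sends the bracket, which is the antisymmetrization of [D], to
   the Lie bracket of the images, which is that of [nabla]. *)
- have : rho (D a b) p - rho (D b a) p
      = nabla (rho a) (rho b) p - nabla (rho b) (rho a) p.
    have -> : rho (D a b) p - rho (D b a) p = rho (fun q => D a b q
      - D b a q) p.
      by rewrite /rho !anchorE linearB /= mulmxBl.
    rewrite (Dsym _ _ fa fb) [LHS](congr1 (@^~ p) (almost_lie a b fa fb)).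
    by rewrite [RHS](congr1 (@^~ p) (Ntor _ _ (rhovf a fa) (rhovf b fb))).
  rewrite /S /eval_metric.
  move: (rho (D a b) p) (rho (D b a) p) (nabla (rho a) (rho b) p)
    (nabla (rho b) (rho a) p) => x y z t xy.
  have metricB u v : ((u - v) *m g p *m (rho c p)^T) 0 0 =
      (u *m g p *m (rho c p)^T) 0 0 - (v *m g p *m (rho c p)^T) 0 0.
    by rewrite !mulmxBl mxE [X in _ + X]mxE.
  by have := congr1 (fun u => (u *m g p *m (rho c p)^T) 0 0) xy;
    rewrite !metricB; lra.
(* Skewness in [b], [c]: by isometry both metric identities expand the same derivative, that of
   [g(rho b, rho c)] along [rho a]; subtracting them gives [S a b c + S a c b = 0]. *)
- have := congr1 (@^~ p) (Nmet _ _ _ (rhovf a fa) (rhovf b fb) (rhovf c fc)).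
  have := congr1 (@^~ p) (Dmet a b c fa fb fc).
  rewrite -(isometry b c)// -!isometry//; [|exact: Dform..].
  rewrite -/rho => -> E; rewrite /S.
  have symg X Y : eval_metric g X Y p = eval_metric g Y X p.
    have [_ sg _] := g_metric.
    rewrite /eval_metric -[Y p in RHS]trmxK -{2}(sg p) -!trmx_mul [RHS]mxE.
    by rewrite mulmxA.
  move: E; rewrite (symg (rho b) (rho (D a c))).
  rewrite (symg (rho b) (nabla (rho a) (rho c))); lra.
Qed.
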